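(* For every $d \in \mathbb{N}$ there exists a $3$-generated subgroup $H_d \leqslant \mathbb{F}_2^d$ such that $H_d$ contains the free abelian group of rank $d$ as a subgroup and $\operatorname{cd}(H_d)=d$.
   Context: $\mathbb{N}=\{1,2,\dots\}$. $\mathbb{F}_2$ denotes the free group of rank $2$ and $\mathbb{F}_2^d$ its $d$-th direct power. A group is $n$-generated if it has a generating set of cardinality at most $n$. $\operatorname{cd}(H)$ denotes the cohomological dimension of a group $H$ over the integers. *)

(* Defs.v *)
From HB Require Import structures.
From mathcomp Require Import all_boot all_order all_algebra.

Set Implicit Arguments.
Unset Strict Implicit.
Unset Printing Implicit Defensive.

Import GRing.Theory.
Local Open Scope ring_scope.

Section ReducedWords.
Variable X : choiceType.

(* The letter (x, true) stands for the generator x, (x, false) for x^-1. *)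
Local Notation letter := (X * bool)%type.

Implicit Types (a b : letter) (u v w : seq letter).

Definition letter_inv a : letter := (a.1, ~~ a.2).

Definition reduced w : bool := sorted (fun a b => b != letter_inv a) w.

Definition push a w : seq letter :=
  if w is b :: w' then if b == letter_inv a then w' else a :: w else [:: a].

(* If [v] is reduced, this is the reduced form of the concatenation [u ++ v]. *)
Definition word_mul u v : seq letter := foldr push v u.

Definition word_inv u : seq letter := rev (map letter_inv u).

Lemma letter_invK : involutive letter_inv.
Proof. by case=> x e; rewrite /letter_inv /= negbK. Qed.

Lemma reduced_behead a w : reduced (a :: w) -> reduced w.
Proof. by case: w => //= b w /andP[]. Qed.

Lemma push_reduced a w : reduced w -> reduced (push a w).
Proof.
case: w => //= b w; case: eqP => [_|/eqP ne] pw; last by rewrite /= ne.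
exact: path_sorted pw.
Qed.

Lemma word_mul_reduced u v : reduced v -> reduced (word_mul u v).
Proof. by move=> rv; elim: u => //= a u; apply: push_reduced. Qed.

Lemma pushK a w : reduced w -> push a (push (letter_inv a) w) = w.
Proof.
case: w => [|b w] /=; first by rewrite eqxx.
rewrite letter_invK; case: eqP => [->|_]; last by rewrite /= eqxx.
by case: w => //= c w /andP[/negPf->].
Qed.

Lemma word_mul_push a v w : reduced w ->
  word_mul (push a v) w = push a (word_mul v w).
Proof.
move=> rw; case: v => //= b v; case: eqP => [->|//].
by rewrite pushK // word_mul_reduced.
Qed.

Lemma word_mulA u v w : reduced w ->
  word_mul u (word_mul v w) = word_mul (word_mul u v) w.
Proof. by move=> rw; elim: u => //= a u ->; rewrite word_mul_push. Qed.

Lemma word_mul1 u : reduced u -> word_mul u [::] = u.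
Proof.
elim: u => //= a u IHu ru; rewrite IHu ?(reduced_behead ru) //.
by case: u ru {IHu} => //= b u /andP[/negPf->].
Qed.

Lemma word_inv_reduced u : reduced u -> reduced (word_inv u).
Proof.
rewrite /reduced /word_inv rev_sorted sorted_map; apply: sub_sorted => a b /=.
by apply: contra => /eqP->; rewrite !letter_invK.
Qed.

Lemma word_invK : involutive word_inv.
Proof. by move=> u; rewrite /word_inv map_rev revK (mapK letter_invK). Qed.

Lemma word_mulV u : word_mul (word_inv u) u = [::].
Proof.
rewrite /word_inv; elim: u => //= a u IHu.
by rewrite rev_cons /word_mul foldr_rcons /= letter_invK eqxx.
Qed.

Record free_group : Type := FreeGroup { word : seq letter; _ : reduced word }.

HB.instance Definition _ := [isSub for word].
HB.instance Definition _ := [Choice of free_group by <:].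

Lemma free_reduced (u : free_group) : reduced (word u).
Proof. exact: valP u. Qed.

Definition free_one : free_group := @FreeGroup [::] isT.
Definition free_mul (u v : free_group) : free_group :=
  FreeGroup (word_mul_reduced (word u) (free_reduced v)).
Definition free_inv (u : free_group) : free_group :=
  FreeGroup (word_inv_reduced (free_reduced u)).

Lemma free_mulA : associative free_mul.
Proof. by move=> u v w; apply/val_inj/word_mulA/free_reduced. Qed.
Lemma free_mul1g : left_id free_one free_mul.
Proof. by move=> u; apply: val_inj. Qed.
Lemma free_mulg1 : right_id free_one free_mul.
Proof. by move=> u; apply/val_inj/word_mul1/free_reduced. Qed.
Lemma free_mulVg : left_inverse free_one free_inv free_mul.
Proof. by move=> u; apply/val_inj/word_mulV. Qed.
Lemma free_mulgV : right_inverse free_one free_inv free_mul.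
Proof.
by move=> u; apply: val_inj; rewrite /= -[in X in word_mul X _](word_invK (word u)) word_mulV.
Qed.

HB.instance Definition _ := isGroup.Build free_group
  free_mulA free_mul1g free_mulg1 free_mulVg free_mulgV.

Definition free_gen (x : X) : free_group := @FreeGroup [:: (x, true)] isT.

End ReducedWords.

Section UniversalProperty.
Variables (X : choiceType) (G : groupType) (f : X -> G).
Local Open Scope group_scope.

Definition letter_val (a : X * bool) : G := if a.2 then f a.1 else (f a.1)^-1.

Definition free_lift (u : free_group X) : G :=
  \prod_(a <- word u) letter_val a.

Lemma prod_push a w :
  \prod_(b <- push a w) letter_val b = letter_val a * \prod_(b <- w) letter_val b.
Proof.
case: w => [|b w] /=; first by rewrite big_seq1 big_nil mulg1.
case: eqP => [->|_]; rewrite !big_cons // mulgA.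
by case: a => x [] /=; rewrite /letter_val /= ?mulgV ?mulVg mul1g.
Qed.

Lemma free_liftM : {morph free_lift : u v / u * v}.
Proof.
move=> u v; rewrite /free_lift /=.
elim: (word u) => [|a w IHw] /=; first by rewrite big_nil mul1g.
by rewrite prod_push IHw big_cons mulgA.
Qed.

HB.instance Definition _ :=
  isMultiplicative.Build (free_group X) G free_lift free_liftM.

Lemma free_lift_gen x : free_lift (free_gen x) = f x.
Proof. by rewrite /free_lift /= big_seq1. Qed.

Lemma free_lift_unique (psi : {multiplicative free_group X -> G}) :
  (forall x, psi (free_gen x) = f x) -> psi =1 free_lift.
Proof.
move=> psiE; have psi1 : psi 1 = 1 by apply: (mulgI (psi 1)); rewrite -gmulfM !mulg1.
case=> w; elim: w => [|a w IHw] rw.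
  by rewrite /free_lift big_nil -psi1; congr (psi _); apply: val_inj.
pose g := free_gen a.1; pose c := if a.2 then g else g^-1.
have psic : psi c = letter_val a.
  rewrite /c /letter_val; case: (a.2); first exact: psiE.
  by apply: (mulgI (psi g)); rewrite -gmulfM mulgV psi1 psiE mulgV.
have rw' := reduced_behead rw.
have -> : FreeGroup rw = c * FreeGroup rw'.
  apply: val_inj; rewrite /c /g; case: a rw {g c psic} => x e rw.
  have /= <- : push (x, e) w = (x, e) :: w.
    by case: (w) rw => //= b v /andP[/negPf->].
  by case: (e).
by rewrite gmulfM psic IHw free_liftM {1}/c; congr (_ * _);
   rewrite /free_lift /c /g; case: a {rw g c psic} => x [] /=; rewrite big_seq1.
Qed.

End UniversalProperty.

Section Subgroup.
Variables (G : groupType) (H : groupClosed G).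

Definition subgroup_of : Type := {x : G | x \in H}.

Lemma groupClosedP : group_closed [in H].
Proof. by split=> [|x y Hx Hy]; [exact: gpred1 | exact: gpredF]. Qed.

HB.instance Definition _ := SubChoice.on subgroup_of.
HB.instance Definition _ :=
  SubChoice_isSubGroup.Build G _ subgroup_of groupClosedP.

End Subgroup.

Inductive generated (G : groupType) (s : seq G) : G -> Prop :=
| generated1 : generated s 1%g
| generated_mem x : x \in s -> generated s x
| generatedF x y : generated s x -> generated s y -> generated s (x / y)%g.

Definition n_generated (n : nat) (G : groupType) : Prop :=
  exists s : seq G, (size s <= n)%N /\ forall x, generated s x.

(* [Algebra.to_multiplicative 'rV[int]_d] is the additive group Z^d written
   multiplicatively, that is, the free abelian group of rank d. *)
Definition contains_free_abelian (d : nat) (G : groupType) : Prop :=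
  exists f : {multiplicative Algebra.to_multiplicative 'rV[int]_d -> G}, injective f.

(* A module over the group ring Z[G] is an abelian group on which G acts by
   additive maps.  The choice structure carried by a [zmodType] is harmless:
   with the axiom of choice every type has one. *)
Record gmodule (G : groupType) : Type := GModule {
  gmod_sort :> zmodType;
  gact : G -> gmod_sort -> gmod_sort;
  gact1 : forall x, gact 1%g x = x;
  gactM : forall g h x, gact (g * h)%g x = gact g (gact h x);
  gactD : forall g, {morph gact g : x y / x + y}
}.

Record ghom (G : groupType) (M N : gmodule G) : Type := GHom {
  ghom_fun :> {additive M -> N};
  ghom_act : forall g x, ghom_fun (gact g x) = gact g (ghom_fun x)
}.

Definition trivial_gmodule (G : groupType) : gmodule G :=
  @GModule G int (fun _ x => x)
    (fun _ => erefl) (fun _ _ _ => erefl) (fun _ _ _ => erefl).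

Definition surj (A B : Type) (f : A -> B) : Prop := forall y, exists x, f x = y.

Definition exact_at (A B C : zmodType) (f : A -> B) (g : B -> C) : Prop :=
  forall y, g y = 0 <-> exists x, f x = y.

Definition projective (G : groupType) (P : gmodule G) : Prop :=
  forall (M N : gmodule G) (p : ghom M N) (f : ghom P N), surj p ->
    exists h : ghom P M, forall x, p (h x) = f x.

(* Z has a projective resolution 0 -> P n -> ... -> P 0 -> Z -> 0 over Z[G];
   it is extended by zero modules in degrees above n. *)
Definition cd_le (G : groupType) (n : nat) : Prop :=
  exists (P : nat -> gmodule G) (d : forall i, ghom (P i.+1) (P i))
         (e : ghom (P 0%N) (trivial_gmodule G)),
    [/\ forall i, projective (P i),
        forall i (x : P i), (n < i)%N -> x = 0,
        surj e,
        exact_at (d 0%N) e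
      & forall i, exact_at (d i.+1) (d i)].

Definition cd_eq (G : groupType) (n : nat) : Prop :=
  cd_le G n /\ forall m, cd_le G m -> (n <= m)%N.

(* Main.v *)
Require Import Defs.
From HB Require Import structures.
From mathcomp Require Import all_boot all_order all_algebra.
From mathcomp Require Import finmap ring.
From mathcomp.multinomials Require Import monalg.
From Stdlib Require Import ClassicalEpsilon.

Set Implicit Arguments.
Unset Strict Implicit.
Unset Printing Implicit Defensive.

Import GRing.Theory Num.Theory.
Local Open Scope ring_scope.

(** Let [F] be the free group on [a] and [b], and let [H] be the subgroup of
    [F^d] generated by [A = (a, ..., a)], [B = (b, ..., b)] and
    [C = (1, a, ..., a^(d-1))].

    Finding Z^d.  The [l]-th coordinate of [C A^-j] is [a^(l-j)], which is
    trivial exactly for [l = j].  Take the commutator of [B] successively with all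
    [C A^-j], [j <> i]: the result [h_i] is trivial in every coordinate but the [i]-th.
    That coordinate is not trivial, because it can be watched in the affine group
    of the line, where [a] acts as the doubling and [b] as the translation by 1:
    a commutator of the translation by [t] with [a^m] is the translation by
    [(2^-m - 1) t], so [h_i] acts through a nonzero translation ([translR],
    [transl_axis_ffun]).  The [h_i] live in different coordinates, hence commute,
    and their translation parts show that they generate a copy of Z^d.

    [cd H <= d].  The group [F^d] acts freely on the product of [d] copies of the
    Cayley tree of [F], a contractible cube complex of dimension [d], whose
    cellular chains form a free resolution of Z over the group ring of every
    subgroup of [F^d].
    Contractibility is witnessed by explicit homotopies: on a tree, a vertex [u]
    is sent to the path from 1 to [u], which is its Fox derivative ([foxM],
    [tree_complex]); on a product, one contracts one factor after the other
    ([tensor_complex]).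

    [cd H >= d].  A projective resolution of length less than [d] would, by
    comparison with the cube resolution, give an equivariant map [r] with
    [r (bd x) = x] on the chains of top degree ([cd_le_top_bd_split]).  Let [z] be
    the product of the paths from 1 to the [i]-th coordinate of [h_i].  It
    projects to the fundamental cycle of a torus: its boundary is a sum of chains
    [h_i y - y] up to sign, so every additive function invariant under the [h_i]
    kills it ([invariant_bd_torus]).  Apply this to [w o r], where [w] is the
    product of [d] copies of the cocycle that measures translation parts of
    paths: [w] is invariant under the [h_i], whose linear part is trivial,
    so [w z = w (r (bd z)) = 0].  But [w z] is the product of the translation parts
    of the [h_i] ([cube_cd_eq]). *)

(** * Free abelian groups on a set *)

Local Notation "'Z[' S ]" := {malg int[S]} (at level 0, S at level 2).

(** Sealed, as are [lin] and [tens] below: comparing two of these by conversion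
    would otherwise unfold the finite maps that represent formal sums. *)
HB.lock Definition basis (S : choiceType) (c : S) : Z[S] := mkmalgU c 1.

HB.lock Definition lin (S : choiceType) (V : zmodType) (f : S -> V) (x : Z[S]) : V :=
  \sum_(c <- msupp x) f c *~ x@_c.

Section Lin.
Variables (S : choiceType) (V : zmodType).
Local Open Scope fset_scope.

Lemma lin_widen (f : S -> V) (x : Z[S]) (D : {fset S}) :
  msupp x `<=` D -> lin f x = \sum_(c <- D) f c *~ x@_c.
Proof.
move=> sxD; rewrite lin.unlock (big_fset_incl _ sxD) // => c _ cx.
by rewrite mcoeff_outdom // mulr0z.
Qed.

Fact lin_is_zmod_morphism (f : S -> V) : zmod_morphism (lin f).
Proof.
move=> x y; pose D := msupp x `|` msupp y.
rewrite (@lin_widen f x D) ?fsubsetUl // (@lin_widen f y D) ?fsubsetUr //.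
rewrite (@lin_widen f (x - y) D) ?msuppB_le // -sumrB.
by apply: eq_bigr => c _; rewrite mcoeffB mulrzBr.
Qed.
HB.instance Definition _ f :=
  GRing.isZmodMorphism.Build Z[S] V (lin f) (lin_is_zmod_morphism f).

Lemma linU (f : S -> V) c : lin f (basis c) = f c.
Proof.
rewrite basis.unlock (@lin_widen f _ [fset c]) ?msuppU_le //.
by rewrite big_seq_fset1 mcoeffUU mulr1z.
Qed.

End Lin.

Section LinTheory.
Variable S : choiceType.

Lemma malg_ind (P : Z[S] -> Prop) :
    P 0 -> (forall c, P (basis c)) -> (forall x y, P x -> P y -> P (x - y)) ->
  forall x, P x.
Proof.
move=> P0 Pc PB x; rewrite [x](monalgEw (fsubset_refl (msupp x))).
have Pm c : P << c >> by have := Pc c; rewrite basis.unlock.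
have PD y z : P y -> P z -> P (y + z).
  by move=> Py Pz; rewrite -[z]opprK; apply: (PB) => //; rewrite -sub0r; apply: (PB).
elim/big_ind: _ => // c _; elim: (x@_c) => [|n IHn|n IHn].
- by rewrite monalgU0.
- by rewrite -addn1 PoszD monalgUD; apply: PD.
- by rewrite -addn1 PoszD opprD monalgUB; apply: PB.
Qed.

Lemma eq_lin (V : zmodType) (f g : S -> V) : f =1 g -> lin f =1 lin g.
Proof. by move=> fg x; rewrite lin.unlock; apply: eq_bigr => c _; rewrite fg. Qed.

Lemma lin_uniq (V : zmodType) (f : {additive Z[S] -> V}) x :
  f x = lin (fun c => f (basis c)) x.
Proof.
elim/malg_ind: x => [|c|x y ex ey]; rewrite ?linU ?raddf0 //.
by rewrite !raddfB ex ey.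
Qed.

Lemma additive_ext (V : zmodType) (f g : {additive Z[S] -> V}) :
  (forall c, f (basis c) = g (basis c)) -> f =1 g.
Proof. by move=> fg x; rewrite [LHS]lin_uniq [RHS]lin_uniq; apply: eq_lin. Qed.

End LinTheory.

(** * Equivariant maps, kernels and lifting *)

Section Modules.
Variable G : groupType.
Implicit Types M N P : gmodule G.

Fact gact_is_nmod_morphism M g : nmod_morphism (@gact G M g).
Proof.
split; last exact: gactD.
by apply: (addrI (gact g 0)); rewrite -gactD !addr0.
Qed.
HB.instance Definition _ M g :=
  GRing.isNmodMorphism.Build M M (@gact G M g) (gact_is_nmod_morphism M g).

Definition mk_ghom M N (f : M -> N) (fB : zmod_morphism f)
    (fG : forall g x, f (gact g x) = gact g (f x)) : ghom M N :=
  let fA : {additive M -> N} :=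
    HB.pack f (GRing.isZmodMorphism.Build M N f fB) in
  @GHom G M N fA fG.

Fact comp_ghomB M N P (f : ghom N P) (h : ghom M N) : zmod_morphism (fun x => f (h x)).
Proof. by move=> x y; rewrite !raddfB. Qed.
Fact comp_ghomG M N P (f : ghom N P) (h : ghom M N) g x :
  f (h (gact g x)) = gact g (f (h x)).
Proof. by rewrite !ghom_act. Qed.
Definition comp_ghom M N P (f : ghom N P) (h : ghom M N) : ghom M P :=
  mk_ghom (comp_ghomB f h) (comp_ghomG f h).

Fact id_ghomB M : zmod_morphism (fun x : M => x). Proof. by []. Qed.
Definition id_ghom M : ghom M M := mk_ghom (@id_ghomB M) (fun _ _ => erefl).

Fact sub_ghomB M N (f h : ghom M N) : zmod_morphism (fun x => f x - h x).
Proof. by move=> x y; rewrite (raddfB f) (raddfB h) !opprD !opprK addrACA. Qed.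
Fact sub_ghomG M N (f h : ghom M N) g x :
  f (gact g x) - h (gact g x) = gact g (f x - h x).
Proof. by rewrite !ghom_act raddfB. Qed.
Definition sub_ghom M N (f h : ghom M N) : ghom M N :=
  mk_ghom (sub_ghomB f h) (sub_ghomG f h).

Fact opp_ghomB M N (f : ghom M N) : zmod_morphism (fun x => - f x).
Proof. by move=> x y; rewrite raddfB opprD. Qed.
Fact opp_ghomG M N (f : ghom M N) g x : - f (gact g x) = gact g (- f x).
Proof. by rewrite ghom_act raddfN. Qed.
Definition opp_ghom M N (f : ghom M N) : ghom M N :=
  mk_ghom (opp_ghomB f) (opp_ghomG f).

Section Kernel.
Variables (M N : gmodule G) (f : ghom M N).

Definition in_gker : {pred M} := fun x => f x == 0.
Fact in_gker_zmod_closed : zmod_closed in_gker.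
Proof.
split=> [|x y]; rewrite !unfold_in /in_gker ?raddf0 // => /eqP fx /eqP fy.
by rewrite raddfB fx fy subrr.
Qed.
HB.instance Definition _ :=
  GRing.isZmodClosed.Build M in_gker in_gker_zmod_closed.

Definition gker_sort : Type := {x : M | x \in in_gker}.
HB.instance Definition _ := SubChoice.on gker_sort.
HB.instance Definition _ := [SubChoice_isSubZmodule of gker_sort by <:].

Fact gker_act_subproof g (x : gker_sort) : gact g (val x) \in in_gker.
Proof. by rewrite unfold_in /in_gker ghom_act (eqP (valP x)) raddf0. Qed.
Definition gker_act g (x : gker_sort) : gker_sort :=
  exist _ (gact g (val x)) (gker_act_subproof g x).
Fact gker_act1 x : gker_act 1%g x = x.
Proof. by apply: val_inj; rewrite /= gact1. Qed.
Fact gker_actM g h x : gker_act (g * h)%g x = gker_act g (gker_act h x).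
Proof. by apply: val_inj; rewrite /= gactM. Qed.
Fact gker_actD g : {morph gker_act g : x y / x + y}.
Proof. by move=> x y; apply: val_inj; rewrite /= gactD. Qed.
Definition gker : gmodule G := GModule gker_act1 gker_actM gker_actD.

Lemma gkerP (x : gker) : f (val (x : gker_sort)) = 0.
Proof. exact/eqP/(valP (x : gker_sort)). Qed.

Definition gker_val : ghom gker M :=
  @mk_ghom gker M (fun x => val (x : gker_sort)) (fun _ _ => erefl) (fun _ _ => erefl).

Section CoRestrict.
Variables (P : gmodule G) (h : ghom P M) (fh0 : forall x, f (h x) = 0).
Let corestr_fun x : gker := exist _ (h x) (introT eqP (fh0 x)).
Fact corestrB : zmod_morphism corestr_fun.
Proof. by move=> x y; apply: val_inj; rewrite /= raddfB. Qed.
Fact corestrG g x : corestr_fun (gact g x) = gact g (corestr_fun x).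
Proof. by apply: val_inj; rewrite /= ghom_act. Qed.
Definition gker_corestr : ghom P gker := mk_ghom corestrB corestrG.
End CoRestrict.

End Kernel.

Lemma projective_retract P Q (i : ghom Q P) (p : ghom P Q) :
  (forall x, p (i x) = x) -> projective P -> projective Q.
Proof.
move=> pi prP M N q f qS.
have [h hE] := prP M N q (comp_ghom f p) qS.
by exists (comp_ghom h i) => x /=; rewrite hE /= pi.
Qed.

(** Projectivity against the surjection of [M] onto the kernel of [d2], through
    which both [d1] and [f] factor. *)
Lemma projective_lift_exact P M N L (d1 : ghom M N) (d2 : ghom N L) (f : ghom P N) :
    projective P -> exact_at d1 d2 -> (forall x, d2 (f x) = 0) ->
  exists h : ghom P M, forall x, d1 (h x) = f x.
Proof.
move=> prP ex d2f.
have d21 x : d2 (d1 x) = 0 by apply/ex; exists x.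
have [|h hE] := prP _ _ (gker_corestr d21) (gker_corestr d2f).
  move=> y; have /ex[x xy] := gkerP y.
  by exists x; apply: val_inj.
by exists h => x; have := congr1 (gker_val d2) (hE x).
Qed.

(** * Free permutation modules *)

Section PermutationModule.
Variables (S : choiceType) (act : G -> S -> S).
Hypotheses (act1 : forall c, act 1%g c = c)
  (actM : forall g h c, act (g * h)%g c = act g (act h c)).

Definition lact g : Z[S] -> Z[S] := lin (fun c => basis (act g c)).
HB.instance Definition _ g := GRing.Additive.copy (lact g) (lin _).

Lemma lactU g c : lact g (basis c) = basis (act g c). Proof. exact: linU. Qed.
Fact lact1 x : lact 1%g x = x.
Proof.
by apply: (additive_ext (g := idfun)) x => c; rewrite /= lactU act1.
Qed.
Fact lactM g h x : lact (g * h)%g x = lact g (lact h x).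
Proof.
apply: (additive_ext (g := lact g \o lact h)) x => c.
by rewrite /= !lactU actM.
Qed.
Fact lactD g : {morph lact g : x y / x + y}. Proof. exact: raddfD. Qed.
Definition perm_gmodule : gmodule G := GModule lact1 lactM lactD.

Hypothesis act_free : forall g c, act g c = c -> g = 1%g.

(** An equivariant lift may be prescribed freely on one representative [rep c] of
    each orbit and spread by the action; freeness makes the element [pos c] that
    carries [rep c] to [c] unique, hence equivariant in [c]. *)
Lemma perm_gmodule_projective : projective perm_gmodule.
Proof.
pose orb c : pred S := fun c' =>
  if excluded_middle_informative (exists g, c = act g c') then true else false.
have orbP c c' : reflect (exists g, c = act g c') (orb c c').
  by rewrite /orb; case: excluded_middle_informative => h; constructor.
have orbc c : orb c c by apply/orbP; exists 1%g.
pose rep c := choose (orb c) c.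
have repP c : {g | c = act g (rep c)}.
  by apply: constructive_indefinite_description; apply/orbP; apply: chooseP.
have rep_act g c : rep (act g c) = rep c.
  have e : orb (act g c) =1 orb c.
    move=> c'; apply/orbP/orbP => [] [h ch].
      by exists (g^-1 * h)%g; rewrite actM -ch -actM mulVg act1.
    by exists (g * h)%g; rewrite actM ch.
  by rewrite /rep (eq_choose e); apply: choose_id; rewrite // -e.
pose pos c := sval (repP c).
have posE c : c = act (pos c) (rep c) := svalP (repP c).
have pos_act g c : pos (act g c) = (g * pos c)%g.
  apply: (mulgI (g * pos c)^-1%g); rewrite mulVg.
  apply: (@act_free _ (rep c)); rewrite actM -{1}(rep_act g) -posE.
  have -> : act g c = act (g * pos c)%g (rep c) by rewrite actM -posE.
  by rewrite -actM mulVg act1.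
move=> M N p f pS.
have lft y : {x | p x = y} by apply: constructive_indefinite_description.
pose m c : M := gact (pos c) (sval (lft (f (basis (rep c))))).
have mG g x : lin m (gact (g : G) (x : perm_gmodule)) = gact g (lin m x).
  apply: (additive_ext (f := lin m \o lact g) (g := gact g \o lin m)) x => c.
  by rewrite /= lactU !linU /m rep_act pos_act gactM.
exists (@mk_ghom perm_gmodule M (lin m) (@lin_is_zmod_morphism _ _ m) mG) => x /=.
apply: (additive_ext (f := p \o lin m)) x => c /=.
rewrite linU /m ghom_act (svalP (lft _)).
by rewrite -ghom_act /= lactU -posE.
Qed.

End PermutationModule.

(** * Comparison of resolutions *)

(** For maps of complexes built degree by degree, [R] says that two consecutive
    components are compatible, and [I] that a component can be continued by one
    more, which is all that the next step of the construction needs. *)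
Lemma dependent_choice (T : nat -> Type) (I : forall n, T n -> Prop)
    (R : forall n, T n -> T n.+1 -> Prop) (x0 : T 0%N) :
    I 0%N x0 -> (forall n x, I n x -> exists y, I n.+1 y /\ R n x y) ->
  exists x : forall n, T n, x 0%N = x0 /\ forall n, R n (x n) (x n.+1).
Proof.
move=> I0 IS; pose st n := {x : T n | I n x}.
have next n (s : st n) : {s' : st n.+1 | R n (sval s) (sval s')}.
  apply: constructive_indefinite_description.
  by have [y [Iy Ry]] := IS n _ (svalP s); exists (exist _ y Iy).
pose s := nat_rect st (exist _ x0 I0) (fun n s => sval (next n s)).
by exists (fun n => sval (s n)); split=> // n; apply: svalP (next n (s n)).
Qed.

Section Comparison.
Variables (C D : nat -> gmodule G).
Variables (dC : forall i, ghom (C i.+1) (C i)) (dD : forall i, ghom (D i.+1) (D i)).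
Hypotheses (dCdC : forall i x, dC i (dC i.+1 x) = 0)
  (dD_exact : forall i, exact_at (dD i.+1) (dD i))
  (C_proj : forall i, projective (C i.+1)).

Lemma chain_map_extension (f0 : ghom (C 0%N) (D 0%N)) : surj (dD 0%N) ->
  exists f : forall i, ghom (C i) (D i),
    f 0%N = f0 /\ forall i x, dD i (f i.+1 x) = f i (dC i x).
Proof.
move=> dD0.
pose R i (u : ghom (C i) (D i)) (v : ghom (C i.+1) (D i.+1)) :=
  forall x, dD i (v x) = u (dC i x).
apply: (dependent_choice (I := fun i u => exists v, R i u v) (R := R)).
  exact: C_proj (comp_ghom f0 (dC 0%N)) dD0.
move=> i u [v uv]; exists v; split=> //.
have vd0 x : dD i (comp_ghom v (dC i.+1) x) = 0 by rewrite /= uv dCdC raddf0.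
exact: (projective_lift_exact (@C_proj _) (@dD_exact i) vd0).
Qed.

Lemma null_homotopy (f : forall i, ghom (C i) (D i)) :
    (forall x, f 0%N x = 0) -> (forall i x, dD i (f i.+1 x) = f i (dC i x)) ->
  exists h : forall i, ghom (C i) (D i.+1),
    forall i x, dD i.+1 (h i.+1 x) = f i.+1 x - h i (dC i x).
Proof.
move=> f0 fd.
pose R i (u : ghom (C i) (D i.+1)) (v : ghom (C i.+1) (D i.+2)) :=
  forall x, dD i.+1 (v x) = f i.+1 x - u (dC i x).
have lift i (u : ghom (C i) (D i.+1)) :
    (forall x, dD i (f i.+1 x - u (dC i x)) = 0) -> exists v, R i u v.
  exact: (projective_lift_exact (f := sub_ghom (f i.+1) (comp_ghom u (dC i)))
    (@C_proj _) (@dD_exact i)).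
have zG g (x : C 0%N) : (0 : D 1%N) = gact g 0 by rewrite raddf0.
have zB : zmod_morphism (fun x : C 0%N => (0 : D 1%N)) by move=> x y; rewrite subr0.
have [||h [_ hR]] := @dependent_choice _ (fun i u => exists v, R i u v) R (mk_ghom zB zG).
- by apply: lift => x /=; rewrite subr0 fd f0.
- move=> i u [v uv]; exists v; split=> //; apply: lift => x.
  by rewrite raddfB fd uv dCdC raddf0 subr0 subrr.
by exists h.
Qed.

End Comparison.

Definition projective_resolution (P : nat -> gmodule G)
    (d : forall i, ghom (P i.+1) (P i))
    (e : ghom (P 0%N) (trivial_gmodule G)) : Prop :=
  [/\ forall i, projective (P i), surj e, exact_at (d 0%N) e
    & forall i, exact_at (d i.+1) (d i)].

Section Augmented.
Variables (P : nat -> gmodule G) (d : forall i, ghom (P i.+1) (P i)).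
Variable e : ghom (P 0%N) (trivial_gmodule G).

(** The resolution shifted by one, with Z in degree 0: the augmentation becomes an
    ordinary boundary map, and comparison maps start from the identity of Z. *)
Definition augmented i := if i is j.+1 then P j else trivial_gmodule G.
Definition augmented_bd i : ghom (augmented i.+1) (augmented i) :=
  match i with 0 => e | j.+1 => d j end.

Hypothesis Pres : projective_resolution d e.

Lemma augmented_exact i : exact_at (augmented_bd i.+1) (augmented_bd i).
Proof. by case: Pres => _ _ ex0 exS; case: i => [|i]; [exact: ex0 | exact: exS]. Qed.
Lemma augmented_bdK i x : augmented_bd i (augmented_bd i.+1 x) = 0.
Proof. by apply/augmented_exact; exists x. Qed.
Lemma augmented_projective i : projective (augmented i.+1).
Proof. by case: Pres => prP _ _ _; apply: prP. Qed.
Lemma augmented_surj : surj (augmented_bd 0).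
Proof. by case: Pres => _ surjP _ _; apply: surjP. Qed.

End Augmented.

(** Compare both ways, [f : Q -> P] and [k : P -> Q]; then [k f - 1] is
    [bd h + h bd] for a homotopy [h].  In degree [n.+1] the term [k f] vanishes
    with [P], and [bd h] vanishes because [h] lands in [Q n.+2]; what remains says
    that [- h] is a left inverse of the boundary map. *)
Lemma short_resolution_split n (P Q : nat -> gmodule G) dP eP dQ eQ :
    @projective_resolution P dP eP -> @projective_resolution Q dQ eQ ->
    (forall x : P n.+1, x = 0) -> (forall x : Q n.+2, x = 0) ->
  exists r : ghom (Q n) (Q n.+1), forall x, r (dQ n x) = x.
Proof.
move=> resP resQ P0 Q0.
have [f [f0 fd]] := chain_map_extension (augmented_bdK resQ) (augmented_exact resP)
  (augmented_projective resQ) (id_ghom _) (augmented_surj resP).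
have [k [k0 kd]] := chain_map_extension (augmented_bdK resP) (augmented_exact resQ)
  (augmented_projective resP) (id_ghom _) (augmented_surj resQ).
have [||h hd] := null_homotopy (augmented_bdK resQ) (augmented_exact resQ)
  (augmented_projective resQ) (f := fun i => sub_ghom (comp_ghom (k i) (f i)) (id_ghom _)).
- by move=> x; rewrite /= k0 f0 /= subrr.
- by move=> i x; rewrite /= raddfB kd fd.
exists (opp_ghom (h n.+1)) => x; have /= := hd n.+1 x.
(* The augmented complexes are shifted by one: h n.+1 starts from Q n. *)
rewrite (Q0 (h n.+2 x)) (P0 (f n.+2 x)) !raddf0 sub0r.
by move=> /eqP; rewrite eq_sym subr_eq0 => /eqP <-; rewrite opprK.
Qed.

End Modules.

(** * Graded chains and tensor products *)

Section Grading.
Variables (S : choiceType) (deg : S -> nat).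

Definition hproj (k : nat) : Z[S] -> Z[S] :=
  lin (fun c => if deg c == k then basis c else 0).
HB.instance Definition _ k := GRing.Additive.copy (hproj k) (lin _).
Definition homog (k : nat) (x : Z[S]) : Prop := hproj k x = x.

Lemma hprojU k c : hproj k (basis c) = if deg c == k then basis c else 0.
Proof. exact: linU. Qed.

Lemma homogU c : homog (deg c) (basis c).
Proof. by rewrite /homog hprojU eqxx. Qed.

Lemma homog_hproj k x : homog k (hproj k x).
Proof.
apply: (additive_ext (f := hproj k \o hproj k)) x => c /=.
by rewrite hprojU; case: eqP => [<-|_]; rewrite ?raddf0 ?homogU.
Qed.

Lemma homog0 k : homog k 0. Proof. exact: raddf0. Qed.
Lemma homogD k x y : homog k x -> homog k y -> homog k (x + y).
Proof. by rewrite /homog => hx hy; rewrite raddfD /= hx hy. Qed.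
Lemma homogN k x : homog k x -> homog k (- x).
Proof. by rewrite /homog => hx; rewrite raddfN /= hx. Qed.
Lemma homogB k x y : homog k x -> homog k y -> homog k (x - y).
Proof. by move=> hx hy; apply: homogD => //; apply: homogN. Qed.
Lemma homogZ k x n : homog k x -> homog k (x *~ n).
Proof. by rewrite /homog => hx; rewrite raddfMz /= hx. Qed.

(** Additive maps are compared on homogeneous chains by precomposing both with the
    projector [hproj k], after which all basis elements can be tested. *)
Lemma eq_homog (V : zmodType) (f g : {additive Z[S] -> V}) k x :
  (forall c, deg c = k -> f (basis c) = g (basis c)) -> homog k x -> f x = g x.
Proof.
move=> fg <-; apply: (additive_ext (f := f \o hproj k) (g := g \o hproj k)) x => c /=.
by rewrite hprojU; case: eqP => [/fg//|_]; rewrite !raddf0.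
Qed.

Lemma homog_eq0 k x : (forall c, deg c != k) -> homog k x -> x = 0.
Proof.
move=> degN; apply: (eq_homog (f := idfun) (g := \0%R)) => c dc.
by have := degN c; rewrite dc eqxx.
Qed.

End Grading.

Lemma homog_additive (S T : choiceType) (degS : S -> nat) (degT : T -> nat) k l
    (f : {additive Z[S] -> Z[T]}) x :
    (forall c, degS c = k -> homog degT l (f (basis c))) ->
  homog degS k x -> homog degT l (f x).
Proof.
by move=> fP; apply: (eq_homog (f := hproj degT l \o f)) => c /fP.
Qed.

HB.lock Definition tens (A B : choiceType) (u : Z[A]) (x : Z[B]) : Z[(A * B)%type] :=
  lin (fun a => lin (fun b => basis (a, b)) x) u.

Section Tensor.
Variables A B : choiceType.

Lemma tensUU (a : A) (b : B) : tens (basis a) (basis b) = basis (a, b).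
Proof. by rewrite tens.unlock !linU. Qed.

Lemma tens0l (x : Z[B]) : tens (0 : Z[A]) x = 0.
Proof. by rewrite tens.unlock raddf0. Qed.
Lemma tensBl (u v : Z[A]) (x : Z[B]) : tens (u - v) x = tens u x - tens v x.
Proof. by rewrite tens.unlock raddfB. Qed.
Lemma tensUl (a : A) (x : Z[B]) : tens (basis a) x = lin (fun b => basis (a, b)) x.
Proof. by rewrite tens.unlock linU. Qed.

Fact tens_is_zmod_morphism (u : Z[A]) : zmod_morphism (@tens A B u).
Proof.
move=> x y; elim/malg_ind: u => [|a|u v eu ev].
- by rewrite !tens0l subr0.
- by rewrite !tensUl raddfB.
- by rewrite !tensBl eu ev !opprD !opprK addrACA.
Qed.
HB.instance Definition _ u :=
  GRing.isZmodMorphism.Build Z[B] Z[(A * B)%type] (tens u) (tens_is_zmod_morphism u).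

Fact tensl_is_zmod_morphism (x : Z[B]) : zmod_morphism ((@tens A B)^~ x).
Proof. by move=> u v; rewrite tensBl. Qed.
(** [tens] with its second argument fixed, for which additivity in the first
    argument can be declared. *)
Definition tensl (x : Z[B]) (u : Z[A]) := tens u x.
HB.instance Definition _ x :=
  GRing.isZmodMorphism.Build Z[A] Z[(A * B)%type] (tensl x) (tensl_is_zmod_morphism x).

Lemma tensDl (u v : Z[A]) (x : Z[B]) : tens (u + v) x = tens u x + tens v x.
Proof. exact: (raddfD (tensl x)). Qed.
Lemma tensNl (u : Z[A]) (x : Z[B]) : tens (- u) x = - tens u x.
Proof. exact: (raddfN (tensl x)). Qed.

End Tensor.

(** * Contractible cell complexes *)

Section Complex.
Variable G : groupType.

(** The cellular chains of a contractible complex of oriented cells, on which [G]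
    acts respecting orientations.  Contractibility is the operator [cell_htp],
    a homotopy from the identity to the retraction onto the vertex [base_cell]. *)
Record cell_complex := CellComplex {
  cell : choiceType;
  cell_act : G -> cell -> cell;
  cell_deg : cell -> nat;
  cell_bd : cell -> Z[cell];
  cell_htp : cell -> Z[cell];
  base_cell : cell;
  cell_act1 : forall c, cell_act 1%g c = c;
  cell_actM : forall g h c, cell_act (g * h)%g c = cell_act g (cell_act h c);
  cell_deg_act : forall g c, cell_deg (cell_act g c) = cell_deg c;
  cell_bd_act : forall g c, cell_bd (cell_act g c) = lact cell_act g (cell_bd c);
  cell_bd_deg : forall k c, cell_deg c = k.+1 -> homog cell_deg k (cell_bd c);
  cell_bd_deg0 : forall c, cell_deg c = 0%N -> cell_bd c = 0;
  cell_bdK : forall c, lin cell_bd (cell_bd c) = 0;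
  base_cell_deg : cell_deg base_cell = 0%N;
  cell_htp_deg : forall c, homog cell_deg (cell_deg c).+1 (cell_htp c);
  cell_htpE : forall c, lin cell_bd (cell_htp c) + lin cell_htp (cell_bd c) =
    (basis c) - (if cell_deg c == 0%N then basis base_cell else 0)
}.

Section Theory.
Variable X : cell_complex.
Notation chains := Z[cell X].

Definition bd : chains -> chains := lin (@cell_bd X).
Definition htp : chains -> chains := lin (@cell_htp X).
Definition act g : chains -> chains := lact (@cell_act X) g.
Definition aug : chains -> int :=
  lin (fun c : cell X => (cell_deg c == 0%N)%:R : int).
(** The chain map induced by collapsing everything to the base vertex. *)
Definition basep : chains -> chains :=
  lin (fun c : cell X => if cell_deg c == 0%N then basis (base_cell X) else 0).
Definition csign : chains -> chains :=
  lin (fun c : cell X => basis c *~ (-1) ^+ cell_deg c).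
HB.instance Definition _ := GRing.Additive.copy bd (lin _).
HB.instance Definition _ := GRing.Additive.copy htp (lin _).
HB.instance Definition _ g := GRing.Additive.copy (act g) (lact _ g).
HB.instance Definition _ := GRing.Additive.copy aug (lin _).
HB.instance Definition _ := GRing.Additive.copy basep (lin _).
HB.instance Definition _ := GRing.Additive.copy csign (lin _).
Local Notation hom := (homog (@cell_deg X)).

Lemma bdU c : bd (basis c) = cell_bd c. Proof. exact: linU. Qed.
Lemma htpU c : htp (basis c) = cell_htp c. Proof. exact: linU. Qed.
Lemma augU c : aug (basis c) = (cell_deg c == 0%N)%:R. Proof. exact: linU. Qed.
Lemma actU g c : act g (basis c) = basis (cell_act g c). Proof. exact: linU. Qed.
Lemma basepU c :
  basep (basis c) = if cell_deg c == 0%N then basis (base_cell X) else 0.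
Proof. exact: linU. Qed.
Lemma csignU c : csign (basis c) = basis c *~ (-1) ^+ cell_deg c.
Proof. exact: linU. Qed.

Lemma bdK x : bd (bd x) = 0.
Proof.
apply: (additive_ext (f := bd \o bd) (g := \0)) x => c /=.
by rewrite bdU; apply: cell_bdK.
Qed.

Lemma bd_act g x : bd (act g x) = act g (bd x).
Proof.
apply: (additive_ext (f := bd \o act g) (g := act g \o bd)) x => c /=.
by rewrite actU !bdU cell_bd_act.
Qed.

Lemma aug_act g x : aug (act g x) = aug x.
Proof.
apply: (additive_ext (f := aug \o act g)) x => c /=.
by rewrite actU !augU cell_deg_act.
Qed.

Lemma hproj_act g k x : hproj (@cell_deg X) k (act g x) = act g (hproj (@cell_deg X) k x).
Proof.
apply: (additive_ext (f := hproj _ k \o act g) (g := act g \o hproj _ k)) x => c /=.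
by rewrite actU !hprojU cell_deg_act; case: eqP => _; rewrite ?actU ?raddf0.
Qed.

Lemma homog_bd k x : hom k.+1 x -> hom k (bd x).
Proof. by apply: homog_additive => c /cell_bd_deg; rewrite /= bdU. Qed.
Lemma homog0_bd x : hom 0 x -> bd x = 0.
Proof. by apply: (eq_homog (g := \0)) => c /cell_bd_deg0; rewrite /= bdU. Qed.
Lemma homog_htp k x : hom k x -> hom k.+1 (htp x).
Proof. by apply: homog_additive => c <-; rewrite /= htpU; apply: cell_htp_deg. Qed.

Lemma basepE x : basep x = basis (base_cell X) *~ aug x.
Proof.
pose f := GRing.isZmodMorphism.Build _ _ _ (mulrzBr (basis (base_cell X))).
pose fA : {additive int -> chains} := HB.pack (fun n => basis (base_cell X) *~ n) f.
apply: (additive_ext (g := fA \o aug)) x => c /=.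
by rewrite basepU augU; case: eqP => _; rewrite ?mulr1z ?mulr0z.
Qed.

Lemma aug_base : aug (basis (base_cell X)) = 1.
Proof. by rewrite augU base_cell_deg. Qed.

Lemma aug_homog k x : hom k.+1 x -> aug x = 0.
Proof. by apply: (eq_homog (g := \0)) => c ck; rewrite /= augU ck. Qed.

Lemma htpE x : bd (htp x) + htp (bd x) = x - basep x.
Proof.
apply: (additive_ext (f := (bd \o htp) \+ (htp \o bd)) (g := idfun \- basep)) x => c.
by rewrite /= bdU htpU basepU; apply: cell_htpE.
Qed.

Lemma bd_basep x : bd (basep x) = 0.
Proof.
have bd0 : bd (basis (base_cell X)) = 0 by rewrite bdU cell_bd_deg0 ?base_cell_deg.
by rewrite basepE raddfMz /= bd0 mul0rz.
Qed.

(** A consequence of the contraction.  Applying [bd] to both sides of [htpE] gives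
    [bd (htp (bd x)) = bd x]; comparing with [htpE] at [bd x] leaves
    [basep (bd x) = 0]. *)
Lemma aug_bd x : aug (bd x) = 0.
Proof.
have e : bd (htp (bd x)) = bd x.
  have := congr1 bd (htpE x).
  by rewrite raddfD raddfB /= bdK bd_basep add0r subr0.
have : bd (htp (bd x)) + htp (bd (bd x)) = _ := htpE (bd x).
rewrite bdK raddf0 addr0 e => /eqP.
rewrite -subr_eq0 opprB addrC subrK basepE => /eqP /(congr1 aug).
by rewrite raddfMz /= aug_base raddf0 intz.
Qed.

Lemma basep_bd x : basep (bd x) = 0.
Proof. by rewrite basepE aug_bd mulr0z. Qed.

Lemma csign_homog k x : hom k x -> csign x = x *~ (-1) ^+ k.
Proof.
pose f := GRing.isZmodMorphism.Build chains chains (fun x => x *~ (-1) ^+ k)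
  (fun x y => mulrzBl x y _).
pose fA : {additive chains -> chains} := HB.pack (fun x : chains => x *~ (-1) ^+ k) f.
by apply: (eq_homog (g := fA)) => c ck /=; rewrite csignU ck.
Qed.

Lemma csignK x : csign (csign x) = x.
Proof.
apply: (additive_ext (f := csign \o csign) (g := idfun)) x => c /=.
by rewrite csignU raddfMz /= csignU -mulrzA -expr2 sqrr_sign mulr1z.
Qed.

Lemma csign_act g x : csign (act g x) = act g (csign x).
Proof.
apply: (additive_ext (f := csign \o act g) (g := act g \o csign)) x => c /=.
by rewrite actU !csignU cell_deg_act raddfMz /= actU.
Qed.

Lemma csign_bd x : csign (bd x) = - bd (csign x).
Proof.
apply: (additive_ext (f := csign \o bd) (g := -%R \o bd \o csign)) x => c /=.
rewrite csignU raddfMz /= bdU; case ck: (cell_deg c) => [|k].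
  by rewrite cell_bd_deg0 // mul0rz raddf0 oppr0.
by rewrite (csign_homog (cell_bd_deg ck)) exprS mulN1r mulrNz opprK.
Qed.

Lemma csign_htp x : csign (htp x) = - htp (csign x).
Proof.
apply: (additive_ext (f := csign \o htp) (g := -%R \o htp \o csign)) x => c /=.
rewrite csignU raddfMz /= htpU (csign_homog (cell_htp_deg c)).
by rewrite exprS mulN1r mulrNz.
Qed.

Lemma csign_basep x : csign (basep x) = basep x.
Proof.
by rewrite basepE raddfMz /= csignU base_cell_deg expr0 mulr1z.
Qed.

Lemma basep_csign x : basep (csign x) = basep x.
Proof.
apply: (additive_ext (f := basep \o csign)) x => c /=.
rewrite csignU raddfMz /= basepU.
by case: eqP => [->|_]; rewrite ?mul0rz // expr0 mulr1z.
Qed.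

End Theory.
End Complex.

(** * Products of cell complexes *)

Lemma homog_tens (A B : choiceType) (degA : A -> nat) (degB : B -> nat) k l u x :
    homog degA k u -> homog degB l x ->
  homog (fun c => degA c.1 + degB c.2)%N (k + l) (tens u x).
Proof.
move=> uk xl; pose P := hproj (fun c : A * B => degA c.1 + degB c.2)%N (k + l).
apply: (eq_homog (f := P \o tensl x) (g := tensl x)) uk => a ak.
apply: (eq_homog (f := P \o tens (basis a)) (g := tens (basis a))) xl => b bl.
by rewrite /= tensUU /P hprojU /= ak bl eqxx.
Qed.

Section TensorComplex.
Variables (G : groupType) (X Y : cell_complex G).
Implicit Types (c : cell X * cell Y) (u : Z[cell X]) (x : Z[cell Y]).

Definition tens_act g c := (cell_act g c.1, cell_act g c.2).
Definition tens_deg c := (cell_deg c.1 + cell_deg c.2)%N.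
Definition tens_bd c :=
  tens (bd (basis (c.1))) (basis (c.2)) + tens (csign (basis (c.1))) (bd (basis (c.2))).
(** Contract the first factor to its base vertex, then the second one along it. *)
Definition tens_htp c :=
  tens (htp (basis (c.1))) (basis (c.2)) + tens (basep (basis (c.1))) (htp (basis (c.2))).

Lemma lact_tens g u x : lact tens_act g (tens u x) = tens (act g u) (act g x).
Proof.
apply: (additive_ext (f := lact tens_act g \o tensl x) (g := tensl _ \o act g)) u => a.
apply: (additive_ext (f := lact tens_act g \o tens _) (g := tens _ \o act g)) x => b.
by rewrite /= /tensl !actU !tensUU lactU.
Qed.

Lemma lin_tens_bd u x :
  lin tens_bd (tens u x) = tens (bd u) x + tens (csign u) (bd x).
Proof.
apply: (additive_ext (f := lin tens_bd \o tensl x)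
  (g := (tensl x \o @bd _ X) \+ (tensl (bd x) \o @csign _ X))) u => a.
apply: (additive_ext (f := lin tens_bd \o tens _) (g := tens _ \+ (tens _ \o @bd _ Y))) x => b.
by rewrite /= tensUU linU.
Qed.

Lemma lin_tens_htp u x :
  lin tens_htp (tens u x) = tens (htp u) x + tens (basep u) (htp x).
Proof.
apply: (additive_ext (f := lin tens_htp \o tensl x)
  (g := (tensl x \o @htp _ X) \+ (tensl (htp x) \o @basep _ X))) u => a.
apply: (additive_ext (f := lin tens_htp \o tens _) (g := tens _ \+ (tens _ \o @htp _ Y))) x => b.
by rewrite /= tensUU linU.
Qed.

Lemma homog_tens_deg k l u x :
    homog (@cell_deg G X) k u -> homog (@cell_deg G Y) l x ->
  homog tens_deg (k + l) (tens u x).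
Proof. exact: homog_tens. Qed.

Fact tens_act1 c : tens_act 1%g c = c.
Proof. by case: c => a b; rewrite /tens_act !cell_act1. Qed.
Fact tens_actM g h c : tens_act (g * h)%g c = tens_act g (tens_act h c).
Proof. by rewrite /tens_act !cell_actM. Qed.
Fact tens_deg_act g c : tens_deg (tens_act g c) = tens_deg c.
Proof. by rewrite /tens_deg !cell_deg_act. Qed.
Fact tens_bd_act g c : tens_bd (tens_act g c) = lact tens_act g (tens_bd c).
Proof.
by rewrite raddfD /= !lact_tens /tens_bd -!csign_act -!bd_act !actU.
Qed.
Fact tens_bd_deg k c : tens_deg c = k.+1 -> homog tens_deg k (tens_bd c).
Proof.
case: c => a b; rewrite {1}/tens_deg /= => abk; apply: homogD => /=.
  case ak: (cell_deg a) abk => [|i] abk.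
    by rewrite bdU cell_bd_deg0 // tens0l; apply: homog0.
  case: abk => <-; apply: homog_tens_deg (homogU _ _).
  by apply: homog_bd; rewrite -ak; apply: homogU.
case bk: (cell_deg b) abk => [|i] abk.
  by rewrite [bd _]bdU cell_bd_deg0 // raddf0; apply: homog0.
move: abk; rewrite addnS => -[<-]; apply: homog_tens_deg; last first.
  by apply: homog_bd; rewrite -bk; apply: homogU.
by rewrite csignU; apply/homogZ/homogU.
Qed.
Fact tens_bd_deg0 c : tens_deg c = 0%N -> tens_bd c = 0.
Proof.
case: c => a b /eqP; rewrite addn_eq0 => /andP[/eqP/= a0 /eqP/= b0].
by rewrite /tens_bd /= !bdU !cell_bd_deg0 // tens0l raddf0 addr0.
Qed.
Fact tens_bdK c : lin tens_bd (tens_bd c) = 0.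
Proof.
rewrite raddfD /= !lin_tens_bd !bdK csign_bd csignK raddf0 tens0l add0r addr0.
by rewrite tensNl addNr.
Qed.
Fact tens_base_deg : tens_deg (base_cell X, base_cell Y) = 0%N.
Proof. by rewrite /tens_deg /= !base_cell_deg. Qed.
Fact tens_htp_deg c : homog tens_deg (tens_deg c).+1 (tens_htp c).
Proof.
apply: homogD.
  rewrite -[(tens_deg c).+1]/((cell_deg c.1).+1 + cell_deg c.2)%N.
  exact: homog_tens_deg (homog_htp (homogU _ _)) (homogU _ _).
rewrite -[(tens_deg c).+1]addnS basepU; case: eqP => [->|_]; last first.
  by rewrite tens0l; apply: homog0.
apply: homog_tens_deg; last by apply/homog_htp/homogU.
by rewrite -(base_cell_deg X); apply: homogU.
Qed.
(** On [u] tensor [x] the mixed terms cancel because [htp] anticommutes with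
    [csign].  The remaining terms are [u - basep u] tensor [x], from the
    contraction of the first factor, and [basep u] tensor [x - basep x], from that
    of the second; they telescope. *)
Fact tens_htpE c : lin tens_bd (tens_htp c) + lin tens_htp (tens_bd c) =
  (basis c) - (if tens_deg c == 0%N then basis (base_cell X, base_cell Y) else 0).
Proof.
case: c => a b; set u := basis a; set x := basis b.
have -> : (if tens_deg (a, b) == 0%N then basis (base_cell X, base_cell Y) else 0)
    = tens (basep u) (basep x).
  rewrite !basepU /tens_deg addn_eq0 /=.
  by do 2?[case: (_ == _) => /=]; rewrite ?tensUU ?tens0l ?raddf0.
rewrite -tensUU !raddfD /= !lin_tens_bd !lin_tens_htp -/u -/x.
rewrite bd_basep basep_bd csign_htp csign_basep basep_csign !tens0l !add0r.
rewrite tensNl addr0 [tens (htp (bd u)) x + _]addrA addrACA.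
rewrite [_ - _ + (_ + _)]addrACA addNr addr0 -tensDl htpE.
by rewrite -raddfD htpE tensBl raddfB /= addrA subrK.
Qed.

Definition tensor_complex : cell_complex G :=
  CellComplex tens_act1 tens_actM tens_deg_act tens_bd_act tens_bd_deg tens_bd_deg0
    tens_bdK tens_base_deg tens_htp_deg tens_htpE.

Lemma bd_tens u x :
  @bd G tensor_complex (tens u x) = tens (bd u) x + tens (csign u) (bd x).
Proof. exact: lin_tens_bd. Qed.

Lemma act_tens g u x :
  @act G tensor_complex g (tens u x) = tens (act g u) (act g x).
Proof. exact: lact_tens. Qed.

End TensorComplex.

(** * The Cayley tree of a free group *)

Section Point.
Variable G : groupType.

Definition point_complex : cell_complex G.
Proof.
apply: (@CellComplex G unit (fun _ c => c) (fun _ => 0%N) (fun _ => 0) (fun _ => 0) tt) => //.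
- by move=> g c; rewrite raddf0.
- by move=> c; rewrite raddf0.
- by move=> c; apply: homog0.
- by case; rewrite !raddf0 /= subrr addr0.
Defined.
End Point.

Section Tree.
Variable X : choiceType.
Local Notation F := (free_group X).
(* The vertex u is (u, None); (u, Some x) is the edge from u to u x. *)
Local Notation tree_cell := (free_group X * option X)%type.
Implicit Types (a : X * bool) (w : seq (X * bool)) (u v : F) (z : Z[tree_cell]).

Definition translate u : Z[tree_cell] -> Z[tree_cell] :=
  lact (fun v (c : tree_cell) => ((v * c.1)%g, c.2)) u.
HB.instance Definition _ u := GRing.Additive.copy (translate u) (lact _ u).

Lemma translateU u c : translate u (basis c) = basis ((u * c.1)%g, c.2).
Proof. exact: lactU. Qed.
Lemma translate1 z : translate 1%g z = z.
Proof. by apply: lact1 => -[u o]; rewrite mul1g. Qed.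
Lemma translateM u v z : translate (u * v)%g z = translate u (translate v z).
Proof. by apply: lactM => {}u {}v c; rewrite mulgA. Qed.

Definition letter_elt a : F := letter_val (@free_gen X) a.
Definition word_elt w : F := (\prod_(a <- w) letter_elt a)%g.

Lemma word_eltK u : word_elt (word u) = u.
Proof. exact: esym (@free_lift_unique X F (@free_gen X) idfun (fun _ => erefl) u). Qed.

Lemma letter_elt_inv a : letter_elt (letter_inv a) = (letter_elt a)^-1%g.
Proof. by case: a => x []; rewrite /letter_elt /letter_val /= ?invgK. Qed.

(** The edge path from 1 to a letter; for an inverse generator it runs backwards
    along the edge that ends at 1. *)
Definition letter_path a : Z[tree_cell] :=
  if a.2 then basis (1%g, Some a.1) else - basis ((free_gen a.1)^-1%g, Some a.1).
Definition word_path w : Z[tree_cell] :=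
  foldr (fun a z => letter_path a + translate (letter_elt a) z) 0 w.
(** The chain of the path from 1 to [u].  Its coefficients are the Fox derivatives
    of [u], and [foxM] is the Leibniz rule of Fox calculus. *)
Definition fox u : Z[tree_cell] := word_path (word u).

Lemma letter_path_inv a :
  translate (letter_elt a) (letter_path (letter_inv a)) = - letter_path a.
Proof.
case: a => x []; rewrite /letter_path /letter_elt /letter_val /=.
  by rewrite raddfN /= translateU /= mulgV.
by rewrite opprK translateU /= mulg1.
Qed.

(** Backtracking does not change the chain of a path, so free reduction is
    harmless. *)
Lemma word_path_push a w :
  word_path (push a w) = letter_path a + translate (letter_elt a) (word_path w).
Proof.
case: w => [|b w] //=; case: eqP => [->|//].
rewrite raddfD /= letter_path_inv addNKr -translateM letter_elt_inv mulgV.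
by rewrite translate1.
Qed.

Lemma foxM u v : fox (u * v)%g = fox u + translate u (fox v).
Proof.
rewrite -{3}(word_eltK u) /fox /= /word_mul; elim: (word u) => [|a w IHw] /=.
  by rewrite /word_elt big_nil translate1 add0r.
by rewrite word_path_push IHw raddfD /= addrA /word_elt big_cons translateM.
Qed.

Lemma fox1 : fox 1%g = 0. Proof. by []. Qed.

Lemma fox_gen x : fox (free_gen x) = basis (1%g, Some x).
Proof. by rewrite /fox /= raddf0 addr0. Qed.

Definition tree_bd (c : tree_cell) : Z[tree_cell] :=
  if c.2 is Some x then basis ((c.1 * free_gen x)%g, None) - basis (c.1, None) else 0.
Definition tree_htp (c : tree_cell) : Z[tree_cell] :=
  if c.2 is Some _ then 0 else fox c.1.

Lemma tree_bd_translate u z : lin tree_bd (translate u z) = translate u (lin tree_bd z).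
Proof.
apply: (additive_ext (f := lin tree_bd \o translate u)
  (g := translate u \o lin tree_bd)) z => -[v [x|]] /=; rewrite translateU !linU /tree_bd /=.
  by rewrite raddfB /= !translateU mulgA.
by rewrite raddf0.
Qed.

Lemma tree_bd_fox u : lin tree_bd (fox u) = basis (u, None) - basis (1%g, None).
Proof.
rewrite -{2}(word_eltK u) /fox; elim: (word u) => [|a w IHw] /=.
  by rewrite /word_elt big_nil raddf0 subrr.
rewrite raddfD /= tree_bd_translate IHw raddfB /= !translateU /= mulg1.
rewrite /word_elt big_cons.
have -> : lin tree_bd (letter_path a) = basis (letter_elt a, None) - basis (1%g, None).
  case: a => x []; rewrite /letter_path /letter_elt /letter_val /=.
    by rewrite linU /tree_bd /= mul1g.
  by rewrite raddfN /= linU /tree_bd /= mulVg opprB.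
by rewrite addrC addrA subrK.
Qed.

Variables (G : groupType) (phi : UMagmaMorphism.type G F).

Definition tree_act g (c : tree_cell) : tree_cell := ((phi g * c.1)%g, c.2).
Definition tree_deg (c : tree_cell) : nat := c.2.

(** [G] acts on the tree through [phi].  That [fox] contracts the edges is the
    Leibniz rule: [fox (u x) - fox u] is the single edge from [u] to [u x]. *)
Definition tree_complex : cell_complex G.
Proof.
apply: (@CellComplex G tree_cell tree_act tree_deg tree_bd tree_htp (1%g, None)).
- by move=> [u o]; rewrite /tree_act gmulf1 mul1g.
- by move=> g h [u o]; rewrite /tree_act gmulfM mulgA.
- by [].
- move=> g c; have := tree_bd_translate (phi g) (basis c).
  by rewrite translateU !linU.
- move=> k [u [x|]] //= -[<-]; apply: homogB; apply: (homogU tree_deg (_, None)).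
- by move=> [u []].
- by move=> [u [x|]]; rewrite /tree_bd /= ?raddfB /= ?linU /= ?subr0 ?raddf0.
- by [].
- move=> [u [x|]]; rewrite /tree_htp /=; first exact: homog0.
  rewrite /fox; elim: (word u) => [|a w IHw] /=; first exact: homog0.
  apply: homogD.
    by case: a => x []; [|apply: homogN]; apply: (homogU tree_deg (_, Some x)).
  apply: homog_additive IHw => -[v o] <-; rewrite /= translateU.
  exact: (homogU tree_deg ((letter_elt a * v)%g, o)).
- move=> [u [x|]]; rewrite /tree_htp /tree_bd /=.
    rewrite raddf0 add0r raddfB /= !linU /= foxM fox_gen addrAC subrr add0r.
    by rewrite translateU /= mulg1 subr0.
  by rewrite raddf0 addr0 -tree_bd_fox.
Defined.

End Tree.

(** * The resolution carried by a cell complex *)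

Section Resolution.
Variables (G : groupType) (X : cell_complex G).

Definition chain_gmodule : gmodule G := perm_gmodule (@cell_act1 G X) (@cell_actM G X).

Definition hproj_ghom k : ghom chain_gmodule chain_gmodule :=
  @mk_ghom G chain_gmodule chain_gmodule (hproj (@cell_deg G X) k)
    (lin_is_zmod_morphism _) (fun g => @hproj_act G X g k).
Definition bd_ghom : ghom chain_gmodule chain_gmodule :=
  @mk_ghom G chain_gmodule chain_gmodule (@bd G X) (lin_is_zmod_morphism _) (@bd_act G X).
Definition aug_ghom : ghom chain_gmodule (trivial_gmodule G) :=
  @mk_ghom G chain_gmodule (trivial_gmodule G) (@aug G X) (lin_is_zmod_morphism _)
    (@aug_act G X).

(** The chains of degree [k], as a kernel; the projector [hproj k] makes them a
    retract of the module of all chains, which is how they are projective. *)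
Definition hchain k : gmodule G := gker (sub_ghom (id_ghom _) (hproj_ghom k)).
Definition hchain_val k : ghom (hchain k) chain_gmodule := gker_val _.

Lemma hchain_homog k (x : hchain k) : homog (@cell_deg G X) k (hchain_val k x).
Proof. by have /eqP := gkerP x; rewrite subr_eq0 eq_sym => /eqP. Qed.

Fact hproj_in_hchain k (x : chain_gmodule) :
  sub_ghom (id_ghom _) (hproj_ghom k) (hproj_ghom k x) = 0.
Proof. by apply/eqP; rewrite subr_eq0 /= homog_hproj. Qed.
Definition hchain_proj k : ghom chain_gmodule (hchain k) := gker_corestr (hproj_in_hchain k).

Lemma hchain_projE k x : homog (@cell_deg G X) k x -> hchain_val k (hchain_proj k x) = x.
Proof. by []. Qed.

Lemma hchain_val_inj k : injective (hchain_val k).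
Proof. by move=> x y /val_inj. Qed.

Definition hchain_bd k : ghom (hchain k.+1) (hchain k) :=
  comp_ghom (hchain_proj k) (comp_ghom bd_ghom (hchain_val k.+1)).
Definition hchain_aug : ghom (hchain 0) (trivial_gmodule G) :=
  comp_ghom aug_ghom (hchain_val 0).

Lemma hchain_bdE k x : hchain_val k (hchain_bd k x) = bd (hchain_val k.+1 x).
Proof. by rewrite hchain_projE //; apply/homog_bd/hchain_homog. Qed.

Hypothesis act_free : forall g (c : cell X), cell_act g c = c -> g = 1%g.

Lemma hchain_projective k : projective (hchain k).
Proof.
apply: (projective_retract (i := hchain_val k) (p := hchain_proj k)).
  by move=> x; apply: hchain_val_inj; rewrite hchain_projE //; apply: hchain_homog.
exact: perm_gmodule_projective.
Qed.

(** By [htpE], a cycle [y] with [aug y = 0] is the boundary of [htp y]; in positive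
    degrees [aug] vanishes. *)
Lemma hchain_resolution : projective_resolution hchain_bd hchain_aug.
Proof.
have preim (y : Z[cell X]) : bd y = 0 -> aug y = 0 -> y = bd (htp y).
  by move=> y0 a0; have := htpE y; rewrite y0 basepE a0 mulr0z subr0 raddf0 addr0.
split.
- exact: hchain_projective.
- move=> n; exists (hchain_proj 0 (basis (base_cell X) *~ n)).
  rewrite /= -[LHS]/(aug (hchain_val 0 (hchain_proj 0 (basis (base_cell X) *~ n)))).
  rewrite hchain_projE ?raddfMz /= ?aug_base ?intz //.
  by apply: homogZ; rewrite -(base_cell_deg X); apply: homogU.
- move=> y; split=> [y0 | [x <-]].
    have yh := hchain_homog y.
    exists (hchain_proj 1 (htp (hchain_val 0 y))); apply: hchain_val_inj.
    rewrite hchain_bdE hchain_projE; last exact: homog_htp.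
    by rewrite -preim // homog0_bd.
  by rewrite /= -[LHS]/(aug (hchain_val 0 (hchain_bd 0 x))) hchain_bdE aug_bd.
- move=> k y; split=> [y0 | [x <-]]; last first.
    by apply: hchain_val_inj; rewrite !hchain_bdE bdK.
  have yh := hchain_homog y.
  exists (hchain_proj k.+2 (htp (hchain_val k.+1 y))); apply: hchain_val_inj.
  rewrite hchain_bdE hchain_projE; last exact: homog_htp.
  by rewrite -preim // ?(aug_homog yh) // -hchain_bdE y0.
Qed.

Variable n : nat.
Hypothesis deg_le : forall c : cell X, (cell_deg c <= n)%N.

Lemma hchain_eq0 k (x : hchain k) : (n < k)%N -> x = 0.
Proof.
move=> nk; apply: hchain_val_inj; rewrite raddf0.
apply: homog_eq0 (hchain_homog x) => c.
by apply: contraTneq nk => <-; rewrite -leqNgt.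
Qed.

Lemma cell_complex_cd_le : cd_le G n.
Proof.
have [prP aS ex0 exS] := hchain_resolution.
by exists hchain, hchain_bd, hchain_aug; split=> // i x; apply: hchain_eq0.
Qed.

End Resolution.

Lemma cd_le_top_bd_split (G : groupType) (X : cell_complex G) n m :
    (forall g (c : cell X), cell_act g c = c -> g = 1%g) ->
    (forall c : cell X, (cell_deg c <= n.+1)%N) -> cd_le G m -> (m <= n)%N ->
  exists r : {additive Z[cell X] -> Z[cell X]},
    (forall g x, r (act g x) = act g (r x)) /\
    (forall x, homog (@cell_deg G X) n.+1 x -> r (bd x) = x).
Proof.
move=> free degn [P [dP [eP [prP P0 surjP ex0 exS]]]] mn.
have resP : projective_resolution dP eP by [].
have [|x|r rE] := short_resolution_split (n := n) resP (hchain_resolution free).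
- by move=> x; apply: P0.
- exact: (hchain_eq0 degn).
pose r' := comp_ghom (hchain_val X n.+1) (comp_ghom r (hchain_proj X n)).
exists r'; split=> [g x | x xh]; first exact: (ghom_act r' g x).
rewrite -[r' _]/(hchain_val X n.+1 (r (hchain_proj X n (bd x)))).
have -> : hchain_proj X n (bd x) = hchain_bd X n (hchain_proj X n.+1 x).
  apply: hchain_val_inj; apply: (etrans (hchain_projE (homog_bd xh))).
  by apply: esym; apply: (etrans (hchain_bdE _)); rewrite (hchain_projE xh).
exact: etrans (congr1 (hchain_val X n.+1) (rE _)) (hchain_projE xh).
Qed.

(** * Products of trees *)

Section Cube.
Variables (X : choiceType) (G : groupType).
Variable phi : nat -> UMagmaMorphism.type G (free_group X).

Fixpoint cube n : cell_complex G :=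
  if n is m.+1 then tensor_complex (tree_complex (phi m)) (cube m) else point_complex G.

Lemma cube_deg_le n (c : cell (cube n)) : (cell_deg c <= n)%N.
Proof.
elim: n c => [|n IHn] //= [c c']; apply: (@leq_add _ _ 1 n) (IHn c').
by rewrite /= /tree_deg; case: isSome.
Qed.

Lemma cube_act_fixed n g (c : cell (cube n)) :
  cell_act g c = c -> forall i, (i < n)%N -> phi i g = 1%g.
Proof.
elim: n c => [|n IHn] //= [[u o] c'] [/= gu gc'] i.
rewrite ltnS leq_eqVlt => /predU1P[->|]; last exact: IHn gc' i.
by apply: (mulIg u); rewrite gu mul1g.
Qed.

Lemma cube_act_trivial n g (x : Z[cell (cube n)]) :
  (forall i, (i < n)%N -> phi i g = 1%g) -> act g x = x.
Proof.
move=> phi1; apply: (additive_ext (f := @act G (cube n) g) (g := idfun)) x => c /=.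
rewrite actU; congr basis; elim: n phi1 c => [|n IHn] //= phi1 [[u o] c'].
rewrite /tens_act /= /tree_act /= phi1 // mul1g IHn // => i i_n.
by apply: phi1; rewrite ltnS ltnW.
Qed.

Variable h : nat -> G.

(** The product of the paths from 1 to [phi i (h i)] in the trees with index
    [i < n].  Modulo the translations [h i] each path closes up to a loop, and
    their product to a torus. *)
Fixpoint torus n : Z[cell (cube n)] :=
  match n with
  | 0 => basis tt
  | m.+1 => tens (fox (phi m (h m)) : Z[cell (tree_complex (phi m))]) (torus m)
  end.

Lemma homog_torus n : homog (@cell_deg G (cube n)) n (torus n).
Proof.
elim: n => [|n IHn]; first exact: (homogU (fun _ : unit => 0%N) tt).
apply: (@homog_tens_deg G (tree_complex (phi n)) (cube n) 1 n _ _ _ IHn).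
exact: (@cell_htp_deg G (tree_complex (phi n)) (phi n (h n), None)).
Qed.

(** By the product formula, the boundary is [h n] minus 1 applied to the product of
    the vertex 1 with [torus n], which invariance under [h n] kills, minus the
    product of the last path with the boundary of [torus n]; tensoring with that
    path keeps invariance under the other [h i], which act trivially on the last
    tree. *)
Lemma invariant_bd_torus n (V : zmodType) (r : {additive Z[cell (cube n)] -> V}) :
    (forall i j, (i < n)%N -> (j < n)%N -> i != j -> phi j (h i) = 1%g) ->
    (forall i, (i < n)%N -> forall x, r (act (h i) x) = r x) ->
  r (bd (torus n)) = 0.
Proof.
elim: n V r => [|n IHn] V r offdiag rinv.
  by rewrite homog0_bd ?raddf0 //; apply: homog_torus.
pose T := tree_complex (phi n); pose u : Z[cell T] := fox (phi n (h n)).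
have h_n i : (i < n)%N -> phi i (h n) = 1%g.
  by move=> i_n; apply: (offdiag n i (ltnSn n) (ltnW i_n)); rewrite gtn_eqF.
rewrite -[torus n.+1]/(tens u (torus n)) bd_tens raddfD.
have bd_u : bd u = basis (phi n (h n), None) - basis (1%g, None) := tree_bd_fox _.
have act_h : (basis (phi n (h n), None)) = @act G T (h n) (basis (1%g, None)).
  by rewrite actU /= /tree_act /= mulg1.
rewrite bd_u tensBl raddfB act_h.
rewrite -{1}(cube_act_trivial (torus n) h_n) -act_tens (rinv n) ?leqnn // subrr add0r.
have rT i x : (i < n)%N -> r (tens (csign u) (act (h i) x)) = r (tens (csign u) x).
  move=> i_n; rewrite -[RHS](rinv i) ?act_tens; last by rewrite ltnS ltnW.
  congr (r (tens _ _)); apply: esym.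
  apply: (additive_ext (f := @act G T (h i)) (g := idfun)) (csign u) => -[v o].
  have phi1 : phi n (h i) = 1%g by apply: offdiag (ltnW i_n) (ltnSn n) _; rewrite ltn_eqF.
  by rewrite /= actU /= /tree_act /= phi1 mul1g.
apply: (IHn _ (r \o tens (csign u))) => [i j i_n j_n|i i_n x /=].
  by apply: offdiag; rewrite ltnS ltnW.
exact: rT.
Qed.

Variables (R : idomainType) (wt : free_group X * option X -> R).

Fixpoint cube_wt n : cell (cube n) -> R :=
  match n with
  | 0 => fun _ => 1
  | m.+1 => fun c => wt c.1 * cube_wt c.2
  end.

Lemma lin_cube_wt n u (x : Z[cell (cube n)]) :
  lin (@cube_wt n.+1) (tens (u : Z[cell (tree_complex (phi n))]) x) =
    lin wt u * lin (@cube_wt n) x.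
Proof.
apply: (additive_ext (f := lin (@cube_wt n.+1) \o tensl x)
  (g := lin (@cube_wt n) x \o* lin wt)) u => a /=.
apply: (additive_ext (f := lin (@cube_wt n.+1) \o tens (basis a))
  (g := lin wt (basis a) \*o lin (@cube_wt n))) x => c /=.
by rewrite tensUU !linU.
Qed.

Lemma lin_cube_wt_torus n :
  lin (@cube_wt n) (torus n) = \prod_(i < n) lin wt (fox (phi i (h i))).
Proof.
elim: n => [|n IHn]; first by rewrite big_ord0 linU.
by rewrite big_ord_recr /= mulrC -IHn lin_cube_wt.
Qed.

Lemma lin_cube_wt_act n g (x : Z[cell (cube n)]) :
    (forall j u o, (j < n)%N -> wt ((phi j g * u)%g, o) = wt (u, o)) ->
  lin (@cube_wt n) (act g x) = lin (@cube_wt n) x.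
Proof.
move=> wtg; apply: (additive_ext (f := lin (@cube_wt n) \o @act G (cube n) g)) x => c /=.
rewrite actU !linU; elim: n wtg c => [|n IHn] //= wtg [[u o] c] /=.
rewrite /tree_act /= wtg // IHn // => j v q j_n.
by apply: wtg; rewrite ltnS ltnW.
Qed.

(** For the lower bound, [r] below is a left inverse of the top boundary map.  The
    weight composed with [r] is invariant under all [h i], hence vanishes on the
    boundary of the torus; but its value there is the weight of the torus, a
    product of nonzero factors. *)
Lemma cube_cd_eq n :
    (forall g, (forall i, (i < n)%N -> phi i g = 1%g) -> g = 1%g) ->
    (forall i j, (i < n)%N -> (j < n)%N -> i != j -> phi j (h i) = 1%g) ->
    (forall i u o, (i < n)%N -> wt ((phi i (h i) * u)%g, o) = wt (u, o)) ->
    (forall i, (i < n)%N -> lin wt (fox (phi i (h i))) != 0) ->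
  cd_eq G n.
Proof.
move=> phi_inj offdiag wt_inv wt_fox.
have free g (c : cell (cube n)) : cell_act g c = c -> g = 1%g.
  by move=> gc; apply: phi_inj; apply: cube_act_fixed gc.
split; first exact: (cell_complex_cd_le free (@cube_deg_le n)).
move=> m cdm; rewrite leqNgt; apply/negP => m_n.
case: n m_n phi_inj offdiag wt_inv wt_fox free => [//|n]; rewrite ltnS => m_n.
move=> phi_inj offdiag wt_inv wt_fox free.
have [r [rG r_bd]] := cd_le_top_bd_split free (@cube_deg_le n.+1) cdm m_n.
have wt_h i : (i < n.+1)%N -> forall x : Z[cell (cube n.+1)],
    lin (@cube_wt n.+1) (act (h i) x) = lin (@cube_wt n.+1) x.
  move=> i_n x; apply: lin_cube_wt_act => j u o j_n.
  by have [<-|ij] := eqVneq i j; [apply: wt_inv | rewrite offdiag ?mul1g].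
have /eqP : lin (@cube_wt n.+1) (r (bd (torus n.+1))) = 0.
  apply: (@invariant_bd_torus _ _ (lin (@cube_wt n.+1) \o r)) => // i i_n x /=.
  by rewrite rG wt_h.
rewrite r_bd; last exact: homog_torus.
by rewrite lin_cube_wt_torus; apply/negP/prodf_neq0 => i _; apply: wt_fox.
Qed.

End Cube.

(** * An affine action of the free group of rank two *)

Section Weight.
Local Notation F := (free_group 'I_2).
Implicit Types u v x y : F.

Definition a_exp u : int :=
  free_lift (fun i : 'I_2 => (i == ord0)%:Z : Algebra.to_multiplicative int) u.

Lemma a_expM u v : a_exp (u * v)%g = a_exp u + a_exp v.
Proof. exact: (@free_liftM _ (Algebra.to_multiplicative int) _ u v). Qed.
Lemma a_exp_gen i : a_exp (free_gen i) = (i == ord0)%:Z.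
Proof. exact: (@free_lift_gen _ (Algebra.to_multiplicative int)). Qed.
Lemma a_exp1 : a_exp 1%g = 0.
Proof. by apply: (addrI (a_exp 1%g)); rewrite -a_expM mulg1 addr0. Qed.
Lemma a_expV u : a_exp u^-1%g = - a_exp u.
Proof. by apply: (addrI (a_exp u)); rewrite -a_expM mulgV a_exp1 subrr. Qed.
Lemma a_expX u n : a_exp (u ^+ n)%g = a_exp u *+ n.
Proof. by elim: n => [|n IHn]; rewrite ?a_exp1 // expgS a_expM IHn mulrS. Qed.

(** [u] acts on the rational line by [t |-> scale u * t + transl u]: the first
    generator doubles and the second one translates by 1. *)
Definition scale u : rat := 2%:Q ^ a_exp u.
Lemma scaleM u v : scale (u * v)%g = scale u * scale v.
Proof. by rewrite /scale a_expM expfzDr. Qed.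
Lemma scale1 : scale 1%g = 1. Proof. by rewrite /scale a_exp1. Qed.
Lemma scaleV u : scale u^-1%g = (scale u)^-1.
Proof. by rewrite /scale a_expV invr_expz. Qed.

(** The cochain whose sum along the path from 1 to [u] is the translation part of
    [u]: only the edges labelled by the translation count, and the one that
    starts at [u] moves by [scale u]. *)
Definition wt (c : F * option 'I_2) : rat :=
  if c.2 is Some i then (if i == ord0 then 0 else scale c.1) else 0.

Definition transl u : rat := lin wt (fox u).

Lemma wt_mul u v o : wt ((u * v)%g, o) = scale u * wt (v, o).
Proof. by case: o => [i|]; rewrite /wt /= ?mulr0 //; case: eqP; rewrite ?mulr0 ?scaleM. Qed.

Lemma translM u v : transl (u * v)%g = transl u + scale u * transl v.
Proof.
rewrite /transl foxM raddfD /=; congr (_ + _).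
apply: (additive_ext (f := lin wt \o translate u) (g := scale u \*o lin wt)) (fox v) => -[w o].
by rewrite /= translateU !linU wt_mul.
Qed.
Lemma transl1 : transl 1%g = 0. Proof. by rewrite /transl fox1 raddf0. Qed.
Lemma translV u : transl u^-1%g = - ((scale u)^-1 * transl u).
Proof. by apply/eqP; rewrite -addr_eq0 -scaleV -translM mulVg transl1. Qed.

(** If [y] is the translation by [t], its conjugate [y ^ x] is the translation by
    [t / scale x]. *)
Lemma translR y x : a_exp y = 0 ->
  transl [~ y, x]%g = ((scale x)^-1 - 1) * transl y.
Proof.
move=> y0; have y1 : scale y = 1 by rewrite /scale y0.
rewrite /commg /conjg !translM !translV scaleV scaleV y1 invr1 !mul1r.
by ring.
Qed.
End Weight.

(** * Integer powers and generated subgroups *)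

Section IntPowers.
Variable G : groupType.
Local Open Scope group_scope.
Implicit Types (x : G) (m n : int).

Definition zpow x n : G := match n with Posz k => x ^+ k | Negz k => x ^- k.+1 end.

Lemma zpowS x n : zpow x (n + 1)%R = zpow x n * x.
Proof.
case: n => [k|[|k]]; first by rewrite -PoszD addn1 /= expgSr.
  by rewrite /= expg1 mulVg.
have -> : (Negz k.+1 + 1)%R = Negz k by rewrite !NegzE -addn1 PoszD opprD subrK.
by rewrite /= [x ^+ k.+2]expgS invgM -mulgA mulVg mulg1.
Qed.

Lemma zpowD x m n : zpow x (m + n)%R = zpow x m * zpow x n.
Proof.
elim: n => [|n IHn|n IHn]; first by rewrite addr0 mulg1.
  by rewrite -addn1 PoszD addrA !zpowS IHn mulgA.
apply: (mulIg x); rewrite -mulgA -!zpowS -addrA.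
by rewrite -addn1 PoszD opprD subrK IHn.
Qed.

Lemma zpow1 n : zpow 1 n = 1.
Proof. by case: n => k; rewrite /= ?expg1n ?invg1. Qed.

Lemma gpred_zpow (S : groupClosed G) n : {in S, forall x, zpow x n \in S}.
Proof. by move=> x; case: n => k; [apply: gpredXn | apply: gpredXNn]. Qed.

End IntPowers.

Lemma zpow_morph (G K : groupType) (f : UMagmaMorphism.type G K) x n :
  f (zpow x n) = zpow (f x) n.
Proof. by case: n => k; rewrite /= ?gmulfV gmulfXn. Qed.

Section GeneratedSubgroup.
Variables (G : groupType) (s : seq G).
Local Open Scope group_scope.

Definition gen_pred : {pred G} :=
  fun x => if excluded_middle_informative (generated s x) then true else false.

Lemma gen_predP x : reflect (generated s x) (x \in gen_pred).
Proof. by rewrite unfold_in; case: excluded_middle_informative => h; constructor. Qed.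

Fact gen_pred1 : 1 \in gen_pred. Proof. exact/gen_predP/generated1. Qed.
Fact gen_predV : invg_closed gen_pred.
Proof.
move=> x /gen_predP sx; apply/gen_predP; rewrite -[x^-1]mul1g.
by apply: generatedF sx; apply: generated1.
Qed.
Fact gen_predM : mulg_closed gen_pred.
Proof.
move=> x y /gen_predP sx /gen_predV /gen_predP sy; apply/gen_predP.
by rewrite -[y]invgK; apply: generatedF.
Qed.

Definition gen_group : groupClosed G :=
  HB.pack gen_pred (isMulClosed.Build G gen_pred gen_predM)
    (isMul1Closed.Build G gen_pred gen_pred1) (isInvClosed.Build G gen_pred gen_predV).

Lemma mem_gen x : x \in s -> x \in gen_group.
Proof. by move=> xs; apply/gen_predP/generated_mem. Qed.

(** Generation in the ambient group has to be replayed inside the subgroup: every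
    intermediate product of a derivation lies in it. *)
Lemma gen_subgroup_n_generated : n_generated (size s) (subgroup_of gen_group).
Proof.
pose t := pmap (insub : G -> option (subgroup_of gen_group)) s.
exists t; split; first by rewrite size_pmap count_size.
move=> [x Hx]; have sx := gen_predP _ Hx.
pose elt y (Hy : y \in gen_group) : subgroup_of gen_group := exist _ y Hy.
rewrite -[exist _ _ _]/(elt x Hx); elim: sx Hx => [|y ys|y z sy IHy sz IHz] Hx.
- have -> : elt 1 Hx = 1 by apply: val_inj.
  exact: generated1.
- by apply: generated_mem; rewrite mem_pmap_sub.
have Hy : y \in gen_group by apply/gen_predP.
have Hz : z \in gen_group by apply/gen_predP.
have -> : elt _ Hx = elt _ Hy / elt _ Hz by apply: val_inj.
by apply: generatedF; [apply: IHy | apply: IHz].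
Qed.

End GeneratedSubgroup.

(** * The three-generated subgroup *)

Section Commutators.
Local Notation F := (free_group 'I_2).

Definition iter_commg (G : groupType) (K : nat -> G) (y : G) (s : seq nat) : G :=
  foldr (fun j z => [~ z, K j]%g) y s.

Lemma iter_commg_morph (G K : groupType) (f : UMagmaMorphism.type G K) k y s :
  f (iter_commg k y s) = iter_commg (f \o k) (f y) s.
Proof. by elim: s => [|j s IHs] //=; rewrite gmulfR IHs. Qed.

Lemma eq_iter_commg (G : groupType) (K K' : nat -> G) y s :
  K =1 K' -> iter_commg K y s = iter_commg K' y s.
Proof. by move=> KK; elim: s => [|j s IHs] //=; rewrite KK IHs. Qed.

Lemma iter_commg_eq1 (G : groupType) (K : nat -> G) y s j :
  j \in s -> K j = 1%g -> iter_commg K y s = 1%g.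
Proof.
move=> js Kj; elim: s js => [|i s IHs] //=; rewrite in_cons.
by case/predU1P => [<-|/IHs->]; rewrite ?Kj ?commg1 ?comm1g.
Qed.

Lemma a_exp_iter_commg K y s : a_exp y = 0 -> a_exp (iter_commg K y s) = 0.
Proof.
move=> y0; elim: s => [|j s IHs] //=.
by rewrite /commg /conjg !a_expM !a_expV IHs oppr0 !add0r addNr.
Qed.

(** Each commutator multiplies the translation part by [2^-m - 1], where [m] is the
    exponent of the first generator in [K j]. *)
Lemma transl_iter_commg K y s : a_exp y = 0 -> transl y != 0 ->
  {in s, forall j, a_exp (K j) != 0} -> transl (iter_commg K y s) != 0.
Proof.
move=> y0 ty; elim: s => [|j s IHs] //= Ks.
rewrite translR ?a_exp_iter_commg // mulf_neq0 ?IHs //; last first.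
  by move=> i si; apply: Ks; rewrite in_cons si orbT.
rewrite subr_eq0 invr_eq1 /scale pexprz_eq1 // orbF.
by apply: Ks; apply: mem_head.
Qed.

Lemma transl_zpow x k : a_exp x = 0 -> transl (zpow x k) = transl x *~ k.
Proof.
move=> x0; have scale_x : scale x = 1 by rewrite /scale x0.
have zS m : transl (zpow x (m + 1)) = transl x + transl (zpow x m).
  by rewrite addrC zpowD translM /= expg1 scale_x mul1r.
elim: k => [|k IHk|k IHk]; first by rewrite transl1.
  by rewrite intS addrC zS IHk mulrzDr mulr1z addrC.
apply: (addrI (transl x)); rewrite -zS intS opprD addrAC addNr add0r IHk.
by rewrite mulrzDr mulrN1z addNKr.
Qed.

End Commutators.

Section Witness.
Variable n : nat.
Local Notation F := (free_group 'I_2).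
Local Notation FF := {ffun 'I_n.+1 -> F}.
Local Notation a := (free_gen (ord0 : 'I_2)).
Local Notation b := (free_gen (ord_max : 'I_2)).

Lemma a_exp_a : a_exp a = 1. Proof. exact: a_exp_gen. Qed.
Lemma a_exp_b : a_exp b = 0. Proof. exact: a_exp_gen. Qed.
Lemma transl_b : transl b = 1.
Proof. by rewrite /transl fox_gen linU /wt /= scale1. Qed.

Definition gA : FF := [ffun _ => a].
Definition gB : FF := [ffun _ => b].
Definition gC : FF := [ffun l : 'I_n.+1 => (a ^+ l)%g].
Definition witness : groupClosed FF := gen_group [:: gA; gB; gC].
Local Notation H := (subgroup_of witness).

Definition ffun_eval (l : 'I_n.+1) (x : FF) : F := x l.
Fact ffun_eval_monoid_morphism l : monoid.monoid_morphism (ffun_eval l).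
Proof. by split=> [|x y]; rewrite /ffun_eval ffunE. Qed.
HB.instance Definition _ l :=
  isUMagmaMorphism.Build FF F (ffun_eval l) (ffun_eval_monoid_morphism l).

Definition coord (i : nat) (x : H) : F := val x (inord i).
Fact coord_monoid_morphism i : monoid.monoid_morphism (coord i).
Proof. by split=> [|x y]; rewrite /coord /= ffunE. Qed.
HB.instance Definition _ i :=
  isUMagmaMorphism.Build H F (coord i) (coord_monoid_morphism i).

(** The commutator with the [j]-th factor erases the [j]-th coordinate, so all
    coordinates but the [i]-th are erased. *)
Definition axis_ffun (i : nat) : FF :=
  iter_commg (fun j => gC * (gA ^+ j)^-1)%g gB [seq j <- iota 0 n.+1 | j != i].

Lemma axis_ffun_in i : axis_ffun i \in witness.
Proof.
have inA : gA \in witness by apply: mem_gen; rewrite !inE eqxx.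
have inB : gB \in witness by apply: mem_gen; rewrite !inE eqxx orbT.
have inC : gC \in witness by apply: mem_gen; rewrite !inE eqxx !orbT.
rewrite /axis_ffun; elim: filter => [//|j s IHs].
by apply: gpredR IHs _; rewrite gpredM // gpredV gpredXn.
Qed.
Definition axis i : H := exist _ (axis_ffun i) (axis_ffun_in i).

Lemma axis_ffunE i (l : 'I_n.+1) :
  axis_ffun i l =
    iter_commg (fun j => a ^+ l * (a ^+ j)^-1)%g b [seq j <- iota 0 n.+1 | j != i].
Proof.
rewrite -[LHS]/(ffun_eval l (axis_ffun i)) iter_commg_morph.
have -> : UMagmaMorphism.sort (ffun_eval l) gB = b by rewrite /= /ffun_eval ffunE.
apply: eq_iter_commg => j /=; rewrite gmulfM gmulfV gmulfXn.
by rewrite /= /ffun_eval !ffunE.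
Qed.

Lemma axis_ffun_eq1 i (l : 'I_n.+1) : l != i :> nat -> axis_ffun i l = 1%g.
Proof.
move=> li; rewrite axis_ffunE; apply: (@iter_commg_eq1 _ _ _ _ l); last exact: mulgV.
by rewrite mem_filter li mem_iota ltn_ord.
Qed.

Lemma a_exp_axis_ffun i (l : 'I_n.+1) : a_exp (axis_ffun i l) = 0.
Proof. by rewrite axis_ffunE a_exp_iter_commg ?a_exp_b. Qed.

Lemma transl_axis_ffun (l : 'I_n.+1) : transl (axis_ffun l l) != 0.
Proof.
rewrite axis_ffunE transl_iter_commg ?a_exp_b ?transl_b ?oner_eq0 // => j.
rewrite mem_filter => /andP[jl _]; rewrite a_expM a_expV !a_expX a_exp_a subr_eq0.
by rewrite eqr_nat eq_sym.
Qed.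

Lemma witness_n_generated : n_generated 3 H.
Proof. exact: gen_subgroup_n_generated. Qed.

Lemma coord_axis i j : (i < n.+1)%N -> (j < n.+1)%N -> i != j -> coord j (axis i) = 1%g.
Proof.
by move=> i_n j_n ij; apply: axis_ffun_eq1; rewrite inordK // eq_sym.
Qed.

Lemma witness_cd_eq : cd_eq H n.+1.
Proof.
have axis_diag i : (i < n.+1)%N ->
    coord i (axis i) = axis_ffun (inord i : 'I_n.+1) (inord i).
  by move=> i_n; rewrite /coord inordK.
apply: (@cube_cd_eq _ H coord axis _ wt).
- move=> g g1; apply/val_inj/ffunP => l.
  by have := g1 l (ltn_ord l); rewrite /= /coord inord_val => ->; rewrite ffunE.
- by move=> i j i_n j_n ij /=; apply: coord_axis.
- by move=> i u o i_n /=; rewrite wt_mul axis_diag // /scale a_exp_axis_ffun expr0z mul1r.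
- by move=> i i_n /=; rewrite axis_diag //; apply: transl_axis_ffun.
Qed.

Definition axis_powers (v : 'rV[int]_n.+1) : FF :=
  [ffun l : 'I_n.+1 => zpow (axis_ffun l l) (v ord0 l)].

(** [axis_powers v] is the product of the powers of the [axis_ffun i]: in each
    coordinate only one factor of the product survives. *)
Lemma axis_powers_in v : axis_powers v \in witness.
Proof.
have -> : axis_powers v = (\prod_(i < n.+1) zpow (axis_ffun i) (v ord0 i))%g.
  apply/ffunP => l; rewrite ffunE -[RHS]/(ffun_eval l _) gmulf_prod.
  rewrite (big_only1 l) //= ?zpow_morph // => i il _.
  by rewrite zpow_morph /= /ffun_eval axis_ffun_eq1 ?zpow1 // eq_sym.
by apply: gpred_prod => i _; apply/gpred_zpow/axis_ffun_in.
Qed.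

Definition axis_embedding (v : Algebra.to_multiplicative 'rV[int]_n.+1) : H :=
  exist _ (axis_powers v) (axis_powers_in v).
Fact axis_embeddingM : {morph axis_embedding : u v / (u * v)%g}.
Proof.
move=> u v; apply/val_inj/ffunP => l; rewrite /= !ffunE -zpowD.
by congr zpow; rewrite mxE.
Qed.
HB.instance Definition _ :=
  monoid.isMultiplicative.Build (Algebra.to_multiplicative 'rV[int]_n.+1) H axis_embedding
    axis_embeddingM.

(** The exponents are read off from the translation parts. *)
Lemma axis_embedding_inj : injective axis_embedding.
Proof.
move=> u v /(congr1 val) /= uv; apply/rowP => l.
have := congr1 (fun x : FF => transl (x l)) uv; rewrite /= !ffunE.
rewrite !transl_zpow ?a_exp_axis_ffun // => /(mulrIz (transl_axis_ffun l)).
by rewrite !ord1.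
Qed.

Lemma witness_contains_free_abelian : contains_free_abelian n.+1 H.
Proof. by exists axis_embedding; apply: axis_embedding_inj. Qed.

End Witness.

Theorem proposition1p1 (d : nat) (d_gt0 : (0 < d)%N) :
  exists H : groupClosed {ffun 'I_d -> free_group 'I_2},
    [/\ n_generated 3 (subgroup_of H),
        contains_free_abelian d (subgroup_of H)
      & cd_eq (subgroup_of H) d].
Proof.
case: d d_gt0 => [//|n] _; exists (witness n); split.
- exact: witness_n_generated.
- exact: witness_contains_free_abelian.
- exact: witness_cd_eq.
Qed.
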